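(* The matroid $R_{10}$ has a unique (inclusion-)minimal tropical basis, and it consists of the fifteen $4$-cycles of $K_5$.
   Context: The matroid $R_{10}$ has as ground set the ten edges of the complete graph $K_5$ on five vertices; its circuits are the (edge sets of the) fifteen $4$-cycles of $K_5$ together with the complements (in the edge set of $K_5$) of the $4$-cycles, for a total of 30 circuits. For a matroid with ground set $[n]$ and collection of circuits $\mathcal{C}$: let $\mathbb{T} = \mathbb{R} \cup \{\infty\}$ and $\mathbb{TP}^{n-1} = (\mathbb{T}^n \setminus \{(\infty,\dots,\infty)\})/\mathbb{R}(1,\dots,1)$. For a circuit $C$ let $\mathcal{T}(C)$ be the set of points $x \in \mathbb{TP}^{n-1}$ such that the minimum of $\{x_i : i \in C\}$ is attained at least twice, i.e. by at least two distinct indices $i \in C$ (this includes the case where all $x_i$, $i\in C$, are $\infty$). For $\mathcal{B} \subset \mathcal{C}$ let $\mathcal{T}(\mathcal{B}) = \bigcap_{C \in \mathcal{B}} \mathcal{T}(C)$. A subset $\mathcal{B} \subset \mathcal{C}$ is a tropical basis if $\mathcal{T}(\mathcal{B}) = \mathcal{T}(\mathcal{C})$. *)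

(* Defs.v *)
From HB Require Import structures.
From mathcomp Require Import boolp classical_sets reals constructive_ereal ereal.
(* Imported last, so that set0, setUC, etc. are those of finset. *)
From mathcomp Require Import all_boot all_order all_algebra generic_quotient.

Set Implicit Arguments.
Unset Strict Implicit.
Unset Printing Implicit Defensive.

Import Order.TTheory GRing.Theory Num.Theory.

Local Open Scope quotient_scope.

Record matroid (T : finType) := Matroid {
  circuits : {set {set T}};
  circuits_nonempty : set0 \notin circuits;
  circuits_antichain :
    {in circuits &, forall C D : {set T}, C \subset D -> C = D};
  circuits_elim : forall C D e, C \in circuits -> D \in circuits -> C != D ->
    e \in C -> e \in D -> exists2 F, F \in circuits & F \subset (C :|: D) :\ e
}.

Section TropicalBasis.
Variables (R : realType) (T : finType).

(* The tropical numbers R `|` {+oo} are the extended reals other than -oo. *)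
Definition is_tropical_vector (x : {ffun T -> \bar R}) : bool :=
  [forall i, x i != -oo%E] && [exists i, x i != +oo%E].

Definition tropical_vector : Type := {x | is_tropical_vector x}.
HB.instance Definition _ := Choice.on tropical_vector.

Definition translate_equiv (x y : tropical_vector) : bool :=
  `[< exists c : R, forall i, val y i = (val x i + c%:E)%E >].

Lemma translate_equiv_refl : reflexive translate_equiv.
Proof. by move=> x; apply/asboolP; exists 0%R => i; rewrite adde0. Qed.

Lemma translate_equiv_sym : symmetric translate_equiv.
Proof.
suff sub x y : translate_equiv x y -> translate_equiv y x.
  by move=> x y; apply/idP/idP; apply: sub.
move=> /asboolP[c xy]; apply/asboolP; exists (- c)%R => i.
by rewrite xy EFinN addeK.
Qed.

Lemma translate_equiv_trans : transitive translate_equiv.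
Proof.
move=> y x z /asboolP[c xy] /asboolP[d yz]; apply/asboolP.
by exists (c + d)%R => i; rewrite yz xy EFinD addeA.
Qed.

Canonical translate_equiv_rel := EquivRel translate_equiv
  translate_equiv_refl translate_equiv_sym translate_equiv_trans.

Definition tropical_projective_space : Type := {eq_quot translate_equiv}.
HB.instance Definition _ := Choice.on tropical_projective_space.
HB.instance Definition _ := Quotient.on tropical_projective_space.

Definition min_attained_twice (C : {set T}) (x : {ffun T -> \bar R}) : Prop :=
  exists i j, [/\ i \in C, j \in C, i != j &
    forall k, k \in C -> (x i <= x k)%E /\ (x j <= x k)%E].

Definition tropical_circuit (C : {set T}) : set tropical_projective_space :=
  [set p : tropical_projective_space |
     min_attained_twice C (val (repr p : tropical_vector))]%classic.

Lemma tropical_circuit_pi (C : {set T}) (x : tropical_vector) :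
  tropical_circuit C (\pi x) <-> min_attained_twice C (val x).
Proof.
have sub (u v : tropical_vector) : translate_equiv u v ->
    min_attained_twice C (val u) -> min_attained_twice C (val v).
  move=> /asboolP[c uv] [i [j [iC jC ij min]]]; exists i, j; split=> // k kC.
  by rewrite !uv !leeD2r //; have [] := min k kC.
have /eqmodP eq : repr (\pi_tropical_projective_space x) =
    x %[mod_eq translate_equiv] by rewrite reprK.
by split; apply: sub => //; rewrite translate_equiv_sym.
Qed.

Definition tropical_variety (B : {set {set T}}) :
    set tropical_projective_space :=
  (\bigcap_(C in [set` B]) tropical_circuit C)%classic.

Definition tropical_basis (M : matroid T) (B : {set {set T}}) : Prop :=
  B \subset circuits M /\ tropical_variety B = tropical_variety (circuits M).

Definition minimal_tropical_basis (M : matroid T) (B : {set {set T}}) : Prop :=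
  minset (fun B' => `[< tropical_basis M B' >]) B.

End TropicalBasis.

Arguments tropical_basis R {T} M B.
Arguments minimal_tropical_basis R {T} M B.

Definition K5_edge : finType := {e : {set 'I_5} | #|e| == 2}.

Definition cycle_edges (s : seq 'I_5) : {set K5_edge} :=
  [set e : K5_edge | has (fun x => val e == [set x; next s x]) s].

Definition K5_four_cycles : {set {set K5_edge}} :=
  [set cycle_edges s | s : 4.-tuple 'I_5 & uniq s].

Definition R10_circuits : {set {set K5_edge}} :=
  K5_four_cycles :|: [set ~: C | C in K5_four_cycles].

(* The circuit axioms are checked by computation, a set of edges being encoded *)
(* as its membership vector along K5_pairs.                                    *)
Section R10_axioms.

Let K5_pairs : seq (nat * nat) :=
  [seq p <- [seq (i, j) | i <- iota 0 5, j <- iota 0 5] | p.1 < p.2].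

Let cycle_code (s : seq nat) : bitseq :=
  [seq has (fun x => ((p.1 == x) && (p.2 == next s x)) ||
                     ((p.1 == next s x) && (p.2 == x))) s | p <- K5_pairs].

Let four_seqs : seq (seq nat) :=
  [seq s <- [seq a :: t | a <- iota 0 5, t <-
     [seq b :: t | b <- iota 0 5, t <-
       [seq [:: c; d] | c <- iota 0 5, d <- iota 0 5]]] | uniq s].

Let four_codes : seq bitseq := undup [seq cycle_code s | s <- four_seqs].

Let circuit_codes : seq bitseq :=
  four_codes ++ [seq map negb c | c <- four_codes].

Let edge_at (p : nat * nat) (e : K5_edge) : bool :=
  val e == [set inord p.1; inord p.2].

Let code (C : {set K5_edge}) : bitseq :=
  [seq [exists e in C, edge_at p e] | p <- K5_pairs].

Let edge_index (e : K5_edge) : nat := find (edge_at^~ e) K5_pairs.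

Let edge_has (e : K5_edge) : has (edge_at^~ e) K5_pairs.
Proof.
have /cards2P[x [y [xy ve]]] := valP e.
wlog lt_xy : x y xy ve / x < y.
  move=> wl; case: (ltngtP x y) => [lt|lt|/val_inj eq]; first exact: (wl x y).
    by apply: (wl y x); rewrite // 1?eq_sym // setUC.
  by rewrite eq eqxx in xy.
apply/hasP; exists (nat_of_ord x, nat_of_ord y);
  last by rewrite /edge_at /= !inord_val ve.
rewrite mem_filter lt_xy; apply/allpairsP; exists (nat_of_ord x, nat_of_ord y).
by split; rewrite // mem_iota ltn_ord.
Qed.

Let edge_index_lt (e : K5_edge) : edge_index e < 10.
Proof. by have := edge_has e; rewrite has_find. Qed.

Let nth_code C (e : K5_edge) : nth false (code C) (edge_index e) = (e \in C).
Proof.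
rewrite (nth_map (0, 0)) //.
have /eqP ve := nth_find (0, 0) (edge_has e).
apply/existsP/idP => [[f /andP[fC /eqP vf]]|eC].
  suff -> : e = f by [].
  by apply: val_inj; rewrite ve vf.
by exists e; rewrite eC; apply/eqP.
Qed.

Let code_inj : injective code.
Proof. by move=> C D eq; apply/setP=> e; rewrite -!nth_code eq. Qed.

Let pair_edge p : p \in K5_pairs -> exists e, edge_at p e.
Proof.
rewrite mem_filter => /andP[lt /allpairsP[[i j] []]].
rewrite !mem_iota /= => i5 j5 eq; subst p; move: lt => /= lt.
have e2 : #|[set inord i; inord j] : {set 'I_5}| == 2.
  by rewrite cards2 -val_eqE /= !inordK // neq_ltn lt.
by exists (exist (fun s : {set 'I_5} => is_true (#|s| == 2)) _ e2);
  rewrite /edge_at.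
Qed.

Let edge_at_inj p e f : edge_at p e -> edge_at p f -> e = f.
Proof. by move=> /eqP ve /eqP vf; apply: val_inj; rewrite ve vf. Qed.

Let exists_edge p e (C : {set K5_edge}) : edge_at p e ->
  [exists f in C, edge_at p f] = (e \in C).
Proof.
move=> pe; apply/existsP/idP => [[f /andP[fC pf]]|eC].
  by rewrite (edge_at_inj pe pf).
by exists e; rewrite eC.
Qed.

Let code_compl C : code (~: C) = map negb (code C).
Proof.
rewrite /code -map_comp; apply/eq_in_map => p /pair_edge[e pe] /=.
by rewrite !(exists_edge _ pe) inE.
Qed.

Let code_cycle (s : seq 'I_5) : uniq s ->
  code (cycle_edges s) = cycle_code (map val s).
Proof.
move=> Us; apply/eq_in_map => p pP; have [e pe] := pair_edge pP.
have [p15 p25 p12] : [/\ p.1 < 5, p.2 < 5 & p.1 != p.2].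
  move: pP; rewrite mem_filter => /andP[lt /allpairsP[[i j] []]].
  by rewrite !mem_iota /= => i5 j5 eq; subst p; rewrite neq_ltn lt.
rewrite (exists_edge _ pe) inE (eqP pe) has_map; apply: eq_has => x /=.
rewrite (next_map val_inj Us) -{2 3}(inordK p15) -{2 3}(inordK p25).
have : (inord p.1 : 'I_5) != inord p.2 by rewrite -val_eqE /= !inordK.
move: (inord p.1 : 'I_5) (inord p.2 : 'I_5) (next s x) => a b y ab.
rewrite !val_eqE; apply/eqP/idP => [eq|]; last first.
  by case/orP=> /andP[/eqP-> /eqP->] //; rewrite setUC.
have : a \in [set x; y] by rewrite -eq set21.
have : b \in [set x; y] by rewrite -eq set22.
rewrite !inE => /orP[]/eqP bE /orP[]/eqP aE; subst a b; rewrite ?eqxx ?orbT //;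
  by rewrite eqxx in ab.
Qed.

Let four_cycle_codeP c : reflect (exists2 C, C \in K5_four_cycles & c = code C)
  (c \in four_codes).
Proof.
rewrite mem_undup; apply: (iffP mapP) => [[s]|[C /imsetP[s]]].
  rewrite mem_filter => /andP[Us /allpairsP[[a t] [aI]]].
  move=> /allpairsP[[b u] [bI /allpairsP[[d e] [dI eI uE]] tE]] sE cE.
  rewrite /= in tE uE sE; subst u t s c.
  move: aI bI dI eI; rewrite !mem_iota => a5 b5 d5 e5.
  pose s : 4.-tuple 'I_5 := [tuple inord a; inord b; inord d; inord e].
  have sE : map val s = [:: a; b; d; e] by rewrite /= !inordK.
  have Us' : uniq s by rewrite -(map_inj_uniq val_inj) sE.
  exists (cycle_edges s); last by rewrite code_cycle // sE.
  by apply/imsetP; exists s; rewrite // inE.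
rewrite inE => Us -> ->; exists (map val s); last by rewrite code_cycle.
rewrite mem_filter map_inj_uniq ?Us; last exact: val_inj.
case: s Us => [[|a [|b [|c' [|d [|]]]]] // sz] _.
have I (x : 'I_5) : val x \in iota 0 5 by rewrite mem_iota /=.
apply: (allpairs_f (fun a (t : seq nat) => a :: t)) => //.
apply: (allpairs_f (fun a (t : seq nat) => a :: t)) => //.
exact: (allpairs_f (fun a b => [:: a; b])).
Qed.

Let circuit_codeP c : reflect (exists2 C, C \in R10_circuits & c = code C)
  (c \in circuit_codes).
Proof.
rewrite mem_cat; apply: (iffP orP) => [[/four_cycle_codeP[C CF ->]|/mapP[_
    /four_cycle_codeP[C CF ->] ->]]|[C]].
- by exists C; rewrite // inE CF.
- by exists (~: C); rewrite ?code_compl // inE imset_f ?orbT.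
rewrite inE => /orP[CF ->|/imsetP[D DF ->] ->].
  by left; apply/four_cycle_codeP; exists C.
right; apply/mapP; exists (code D); last by rewrite code_compl.
by apply/four_cycle_codeP; exists D.
Qed.

Let mem_code C : (code C \in circuit_codes) = (C \in R10_circuits).
Proof.
apply/circuit_codeP/idP => [[D DR /code_inj ->] //|CR]; by exists C.
Qed.

Let subcode (c d : bitseq) := all (fun k => nth false c k ==> nth false d k)
  (iota 0 10).

Let size_code C : size (code C) = 10. Proof. by rewrite size_map. Qed.

Let subcodeP (C D : {set K5_edge}) :
  reflect (C \subset D) (subcode (code C) (code D)).
Proof.
apply: (iffP allP) => [sub|/subsetP sub k].
  apply/subsetP=> e eC; have := sub (edge_index e).
  by rewrite !nth_code eC mem_iota; apply; exact: edge_index_lt.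
rewrite mem_iota => k10; apply/implyP.
rewrite !(nth_map (0, 0)) // => /existsP[e /andP[eC ke]].
by apply/existsP; exists e; rewrite sub.
Qed.

Lemma R10_nonempty : set0 \notin R10_circuits.
Proof.
rewrite -mem_code; apply/negP => in0.
have chk : all (has id) circuit_codes by vm_compute.
have /hasP[b /mapP[p _ ->]] := allP chk _ in0.
by case/existsP=> e; rewrite inE.
Qed.

Lemma R10_antichain :
  {in R10_circuits &, forall C D : {set K5_edge}, C \subset D -> C = D}.
Proof.
have chk : all (fun c => all (fun d => subcode c d ==> (c == d)) circuit_codes)
  circuit_codes by vm_compute.
move=> C D; rewrite -!mem_code => CR DR /subcodeP sub.
by have /implyP/(_ sub)/eqP/code_inj := allP (allP chk _ CR) _ DR.
Qed.

Let elim_ok (codes : seq bitseq) := all (fun c => all (fun d => (c != d) ==>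
  all (fun k => (nth false c k && nth false d k) ==> has (fun f =>
    all (fun l => nth false f l ==>
      (l != k) && (nth false c l || nth false d l)) (iota 0 10))
  codes) (iota 0 10)) codes) codes.

Let elim_okP codes : elim_ok codes ->
  forall c d k, c \in codes -> d \in codes -> c != d -> k < 10 ->
    nth false c k -> nth false d k ->
  exists2 f, f \in codes & forall l, l < 10 -> nth false f l ->
    (l != k) && (nth false c l || nth false d l).
Proof.
move=> ok c d k cs ds cd k10 ck dk.
have /implyP/(_ cd)/allP/(_ k) := allP (allP ok _ cs) _ ds.
rewrite mem_iota ck dk => /(_ k10)/hasP[f fs /allP sub]; exists f => // l l10.
by apply/implyP/sub; rewrite mem_iota.
Qed.

Lemma R10_elim C D e : C \in R10_circuits -> D \in R10_circuits -> C != D ->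
  e \in C -> e \in D ->
  exists2 F, F \in R10_circuits & F \subset (C :|: D) :\ e.
Proof.
have chk : elim_ok circuit_codes by vm_compute.
rewrite -(inj_eq code_inj) -!mem_code -!(nth_code _ e) => CR DR CD eC eD.
have [_ /circuit_codeP[F FR ->] sub] :=
  elim_okP chk CR DR CD (edge_index_lt e) eC eD.
exists F; [exact: FR|clear chk; apply/subsetP=> f; rewrite -nth_code].
move=> /(sub _ (edge_index_lt f)); rewrite !nth_code => /andP[ne CDf].
by rewrite !inE CDf andbT; apply: contra ne => /eqP->.
Qed.

Lemma card_K5_four_cycles : #|K5_four_cycles| = 15.
Proof.
rewrite cardE -(size_map code).
transitivity (size four_codes); last by vm_compute.
apply/perm_size/uniq_perm => [||c].
- by rewrite (map_inj_uniq code_inj) enum_uniq.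
- exact: undup_uniq.
by apply/mapP/four_cycle_codeP => -[C]; rewrite ?mem_enum => CF cE; exists C;
  rewrite ?mem_enum.
Qed.

Lemma card_R10_circuits : #|R10_circuits| = 30.
Proof.
rewrite cardE -(size_map code).
transitivity (size circuit_codes); last by vm_compute.
apply/perm_size/uniq_perm => [||c].
- by rewrite (map_inj_uniq code_inj) enum_uniq.
- by vm_compute.
by apply/mapP/circuit_codeP => -[C]; rewrite ?mem_enum => CF cE; exists C;
  rewrite ?mem_enum.
Qed.

End R10_axioms.

Definition R10 : matroid K5_edge :=
  Matroid R10_nonempty R10_antichain R10_elim.

(* Main.v *)
Require Import Defs.
From mathcomp Require Import boolp classical_sets constructive_ereal.
From mathcomp Require Import all_boot all_order all_algebra reals.
From mathcomp Require Import generic_quotient.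

Set Implicit Arguments.
Unset Strict Implicit.
Unset Printing Implicit Defensive.

Import Order.TTheory.

Local Open Scope quotient_scope.

(** Write T(C) for the points where the minimum over C is attained twice.

    The 4-cycles suffice because every other circuit is the symmetric
    difference of two 4-cycles with exactly one common edge. The complement of
    the 4-cycle abcd in K5, with fifth vertex e, consists of the triangles
    ace and bde; cutting this bow tie along the chord ab gives the
    4-cycles aceb and abde, which meet in the edge ab only
    ([bowtie_symdiff]). Such a symmetric difference imposes nothing new: if
    C1 and C2 meet in f alone, then T(C1) and T(C2) together imply T of the
    symmetric difference, a tropical form of eliminating f
    ([min_attained_twice_symdiff]).

    No 4-cycle C can be dispensed with. Let P consist of three of its edges,
    and take the vector equal to +oo on P and to 0 elsewhere. It lies in T(D)
    when D has at least two elements off P, and it does not lie in T(C), as C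
    has exactly one. Any circuit D other than C does have two: a 4-cycle that
    contains the path P is closed up by the fourth edge of C
    ([four_cycle_of_path]), and the complement of a 4-cycle has six elements.
    So every tropical basis contains every 4-cycle
    ([four_cycles_sub_tropical_basis]).

    A tropical basis included in all the others is the unique minimal one. *)

(** * Tropical bases of a matroid *)

Section Tropical.
Variables (R : realType) (T : finType).
Implicit Types (x : {ffun T -> \bar R}) (C P : {set T}).

(** The second condition compares values one pair at a time, so chains of
    inequalities can be followed without first locating a minimum; as C is
    finite, it holds at a minimal index and gives a second minimal index. *)
Lemma min_attained_twiceP C x : min_attained_twice C x <->
  C != set0 /\
  {in C, forall i, exists j, [/\ j \in C, j != i & (x j <= x i)%E]}.
Proof.
split=> [[u [v [uC vC uv le_uv]]]|[/set0Pn[i0 i0C] others]].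
  split; first by apply/set0Pn; exists u.
  move=> i /le_uv[le_ui le_vi]; have [ui|ui] := eqVneq u i; last by exists u.
  by exists v; split; rewrite // -ui eq_sym.
case: (arg_minP x i0C) => i iC le_i; have [j [jC ji le_ji]] := others i iC.
exists j, i; split=> // k kC; have le_ik := le_i k kC.
by split; rewrite // (le_trans le_ji).
Qed.

(** An index i of C1 is matched within C1 by another index with a value at
    most as large. If the match is f, then f is itself matched within C2 by
    some k other than f; and k differs from i, as i is not in C2. *)
Lemma min_attained_twice_symdiff C1 C2 f x : C1 :&: C2 = [set f] ->
  min_attained_twice C1 x -> min_attained_twice C2 x ->
  min_attained_twice ((C1 :|: C2) :\ f) x.
Proof.
have half A B : A :&: B = [set f] ->
    min_attained_twice A x -> min_attained_twice B x ->
    {in A :\ f, forall i, exists j,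
      [/\ j \in (A :|: B) :\ f, j != i & (x j <= x i)%E]}.
  move=> AB /min_attained_twiceP[_ minA] /min_attained_twiceP[_ minB] i.
  have fB : f \in B by have := set11 f; rewrite -AB => /setIP[].
  move=> /setD1P[i_f iA]; have [j [jA ji le_ji]] := minA i iA.
  have [j_f|j_f] := eqVneq j f; last by exists j; rewrite !inE j_f jA.
  (* The value at f is at most x i; B has another value at most that. *)
  have [k [kB k_f le_kf]] := minB f fB; exists k; split.
  - by rewrite !inE k_f kB orbT.
  - apply: contraNneq k_f => k_i.
    by rewrite -in_set1 -AB inE kB k_i iA.
  - by rewrite (le_trans le_kf) // -j_f.
move=> C12 min1 min2; apply/min_attained_twiceP; split.
  have fC1 : f \in C1 by have := set11 f; rewrite -C12 => /setIP[].
  have [_ /(_ f fC1)[i [iC1 i_f _]]] := (min_attained_twiceP C1 x).1 min1.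
  by apply/set0Pn; exists i; rewrite !inE i_f iC1.
move=> i; rewrite setDUl => /setUP[|] iD; rewrite -setDUl.
  exact: (half C1 C2).
by rewrite setUC; apply: half => //; rewrite setIC.
Qed.

(** The point that shows C to be indispensable is +oo on P and 0 off P: its
    minimum over a set is attained twice as soon as two elements lie off P,
    and only once if exactly one does. *)
Lemma tropical_basis_mem (M : matroid T) (B : {set {set T}}) C P :
  tropical_basis R M B -> C \in circuits M -> #|C :\: P| = 1 ->
  {in circuits M, forall D, D != C -> 1 < #|D :\: P|} -> C \in B.
Proof.
move=> [/subsetP BM eqTB] CM C1 big.
have /cards1P[e CPe] : #|C :\: P| == 1 by apply/eqP.
pose x : {ffun T -> \bar R} := [ffun i => if i \in P then +oo%E else 0%E].
have x_ge0 i : (0 <= x i)%E by rewrite ffunE; case: ifP => // _; rewrite leey.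
have x_tropical : is_tropical_vector x.
  apply/andP; split; first by apply/forallP=> i; rewrite ffunE; case: ifP.
  apply/existsP; exists e; rewrite ffunE.
  by have := set11 e; rewrite -CPe inE => /andP[/negPf->].
pose X : tropical_vector R T := exist _ x x_tropical.
have [//|CB] := boolP (C \in B); exfalso.
have : tropical_variety B (\pi_(tropical_projective_space R T) X).
  move=> D /= DB; apply/tropical_circuit_pi.
  have DC : D != C by apply: contraNneq CB => <-.
  have /card_gt1P[i [j [/setDP[iD iP] /setDP[jD jP] ij]]] := big D (BM D DB) DC.
  exists i, j; split=> // k _.
  have x0 l : l \notin P -> x l = 0%E by rewrite ffunE => /negPf->.
  by rewrite /= (x0 i) // (x0 j) //; split; apply: x_ge0.
rewrite eqTB => /(_ C CM)/tropical_circuit_pi /= minC.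
have eC : e \in C by have := set11 e; rewrite -CPe => /setDP[].
have eP : e \notin P by have := set11 e; rewrite -CPe => /setDP[].
have [_ /(_ e eC)[j [jC je]]] := (min_attained_twiceP C x).1 minC.
rewrite !ffunE (negPf eP); case: ifP => // jP _.
have : j \in C :\: P by rewrite inE jC jP.
by rewrite CPe inE (negPf je).
Qed.

Lemma unique_minimal_tropical_basis (M : matroid T) (B : {set {set T}}) :
  tropical_basis R M B ->
  (forall B', tropical_basis R M B' -> B \subset B') ->
  unique (minimal_tropical_basis R M) B.
Proof.
move=> basB leB; split.
  apply/minsetP; split=> [|B' /asboolP/leB BB' B'B]; first exact/asboolP.
  by apply/eqP; rewrite eqEsubset B'B.
move=> B' /minsetP[/asboolP/leB BB' minB'].
by apply: minB' => //; apply/asboolP.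
Qed.

End Tropical.

(** * Edges and 4-cycles of K5 *)

Lemma set2_eqE (V : finType) (x y u v : V) : x != y ->
  ([set x; y] == [set u; v]) =
  ((x == u) && (y == v)) || ((x == v) && (y == u)).
Proof.
move=> xy; apply/eqP/idP => [eq_xy|]; last first.
  by case/orP=> /andP[/eqP-> /eqP->] //; rewrite setUC.
have : x \in [set u; v] by rewrite -eq_xy set21.
have : y \in [set u; v] by rewrite -eq_xy set22.
rewrite !inE => /orP[]/eqP yE /orP[]/eqP xE; subst x y; rewrite ?eqxx ?orbT //;
  by rewrite eqxx in xy.
Qed.

Lemma K5_edgeP (e : K5_edge) : exists x y, x != y /\ val e = [set x; y].
Proof. by have /cards2P[x [y [xy eE]]] := valP e; exists x, y. Qed.

Lemma K5_edge_of (x y : 'I_5) : x != y ->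
  exists e : K5_edge, val e = [set x; y].
Proof.
move=> xy; have e2 : #|[set x; y]| == 2 by rewrite cards2 xy.
by exists (exist (fun s : {set 'I_5} => is_true (#|s| == 2)) _ e2).
Qed.

(** Decides the equality tests between vertices that the hypotheses tell
    apart; with all edges and cycles spelled out by their vertices, this
    settles incidence questions by case analysis. *)
Ltac simpl_distinct := rewrite /=; repeat match goal with
  | |- context [?x == ?x] => rewrite eqxx /=
  | H : is_true (?x != ?y) |- context [?x == ?y] => rewrite (negPf H) /=
  | H : is_true (?x != ?y) |- context [?y == ?x] =>
      rewrite [y == x]eq_sym (negPf H) /=
  end.

Lemma mem_cycle_edges4 (a b c d : 'I_5) (e : K5_edge) : uniq [:: a; b; c; d] ->
  (e \in cycle_edges [:: a; b; c; d]) =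
  (val e \in [:: [set a; b]; [set b; c]; [set c; d]; [set d; a]]).
Proof.
rewrite /= !inE !negb_or => /and4P[/and3P[ab ac ad] /andP[bc bd] cd _].
by simpl_distinct; rewrite orbF.
Qed.

Lemma card_K5_edge : #|K5_edge| = 10.
Proof.
rewrite card_sig -[RHS](_ : #|[set A : {set 'I_5} | #|A| == 2]| = 10).
  by apply: eq_card => A; rewrite !inE.
by rewrite card_draws card_ord.
Qed.

Lemma card_cycle_edges4 (a b c d : 'I_5) : uniq [:: a; b; c; d] ->
  #|cycle_edges [:: a; b; c; d]| = 4.
Proof.
move=> Us; rewrite -(card_imset _ val_inj).
set l := [:: [set a; b]; [set b; c]; [set c; d]; [set d; a]].
have := Us; rewrite /= !inE !negb_or.
move=> /and4P[/and3P[ab ac ad] /andP[bc bd] cd _].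
have Ul : uniq l.
  by rewrite /= !inE !set2_eqE //; simpl_distinct.
rewrite -[RHS](card_uniqP Ul); apply: eq_card => A.
apply/imsetP/idP => [[e eC ->]|Al].
  by rewrite -mem_cycle_edges4.
suff [e eA] : exists e : K5_edge, val e = A.
  by exists e; rewrite // mem_cycle_edges4 // eA.
move: Al; rewrite !inE => /or4P[]/eqP->; apply: K5_edge_of => //.
by rewrite eq_sym.
Qed.

Lemma K5_four_cycleP C : reflect
  (exists a b c d : 'I_5,
    uniq [:: a; b; c; d] /\ C = cycle_edges [:: a; b; c; d])
  (C \in K5_four_cycles).
Proof.
apply: (iffP imsetP) => [[s]|[a [b [c [d [Us ->]]]]]].
  rewrite inE; case: s => [[|a [|b [|c [|d [|]]]]] //= sz] Us ->.
  by exists a, b, c, d.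
by exists [tuple a; b; c; d]; rewrite ?inE.
Qed.

Lemma R10_circuitP C : reflect
  (exists a b c d : 'I_5, uniq [:: a; b; c; d] /\
    (C = cycle_edges [:: a; b; c; d] \/ C = ~: cycle_edges [:: a; b; c; d]))
  (C \in circuits R10).
Proof.
rewrite inE; apply: (iffP orP) => [[/K5_four_cycleP|/imsetP[D]]|].
- by move=> [a [b [c [d [Us ->]]]]]; exists a, b, c, d; split; last left.
- move=> /K5_four_cycleP[a [b [c [d [Us ->]]]]] ->.
  by exists a, b, c, d; split; last right.
move=> [a [b [c [d [Us [->|->]]]]]]; [left|right; apply: imset_f];
  by apply/K5_four_cycleP; exists a, b, c, d.
Qed.

Lemma fifth_vertex (a b c d : 'I_5) : uniq [:: a; b; c; d] ->
  exists e, uniq [:: a; b; c; d; e].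
Proof.
move=> Us; have [e eN] : exists e, e \notin [:: a; b; c; d].
  apply/existsP; rewrite -negb_forall; apply/negP => /forallP all_s.
  have := uniq_leq_size (enum_uniq 'I_5) (fun x _ => all_s x).
  by rewrite size_enum_ord.
by exists e; rewrite -[X in uniq X]/(rcons [:: a; b; c; d] e) rcons_uniq eN.
Qed.

Lemma mem_all_vertices (s : seq 'I_5) x : uniq s -> size s = 5 -> x \in s.
Proof.
move=> Us s5; have [|_ ->] := uniq_min_size Us (fun x _ => mem_enum 'I_5 x).
  by rewrite size_enum_ord s5.
by rewrite mem_enum.
Qed.

(** Away from abcd, the edges of K5 form the triangles ace and bde. If these
    exchange their sides ae and be, the paths ac, ce, eb and bd, de, ea arise;
    both run between a and b, and the chord ab closes them to 4-cycles. *)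
Lemma bowtie_symdiff (a b c d e : 'I_5) (f : K5_edge) :
  uniq [:: a; b; c; d; e] -> val f = [set a; b] ->
  let C1 := cycle_edges [:: a; c; e; b] in
  let C2 := cycle_edges [:: a; b; d; e] in
  C1 :&: C2 = [set f] /\ ~: cycle_edges [:: a; b; c; d] = (C1 :|: C2) :\ f.
Proof.
move=> Us fE C1 C2.
move: (Us); rewrite [uniq _]/= !inE !negb_or.
move=> /and5P[/and4P[ab ac ad ae] /and3P[bc bd be] /andP[cd ce] de _].
have [U0 [U1 U2]] : uniq [:: a; b; c; d] /\
    uniq [:: a; c; e; b] /\ uniq [:: a; b; d; e].
  by rewrite /= !inE; simpl_distinct.
have eq_f g : (g == f) = (val g == [set a; b]) by rewrite -fE.
suff memE g : ((g \in C1) && (g \in C2) = (g == f)) /\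
    ((g \notin cycle_edges [:: a; b; c; d]) =
     (g != f) && ((g \in C1) || (g \in C2))).
  by split; apply/setP=> g; have [] := memE g;
    rewrite ?(in_setI, in_set1, in_setC, in_setD1, in_setU).
rewrite eq_f !mem_cycle_edges4 // !inE.
have [x [y [xy ->]]] := K5_edgeP g; rewrite !set2_eqE //; clear C1 C2.
have := mem_all_vertices x Us erefl; have := mem_all_vertices y Us erefl.
move: xy; rewrite !inE => /[swap] /or4P[|||/orP[]] /eqP-> /[swap].
all: move=> /or4P[|||/orP[]] /eqP-> //; rewrite ?eqxx // => _.
all: by simpl_distinct.
Qed.

(** A 4-cycle that passes through the path abcd visits no other vertex, so it
    has to return from d to a. *)
Lemma four_cycle_of_path (a b c d : 'I_5) (f : K5_edge) (C : {set K5_edge}) :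
  uniq [:: a; b; c; d] -> val f = [set d; a] -> C \in K5_four_cycles ->
  cycle_edges [:: a; b; c; d] :\ f \subset C -> C = cycle_edges [:: a; b; c; d].
Proof.
move=> Us fE /K5_four_cycleP[p [q [r [t [Ut ->]]]]] /subsetP path_sub.
suff fC : f \in cycle_edges [:: p; q; r; t].
  apply/esym/eqP; rewrite eqEcard !card_cycle_edges4 // leqnn andbT.
  apply/subsetP=> g gC; have [-> //|gf] := eqVneq g f.
  by apply: path_sub; rewrite in_setD1 gf.
rewrite mem_cycle_edges4 // fE.
move: (Us) (Ut); rewrite ![uniq _]/= !inE !negb_or.
move=> /and4P[/and3P[ab ac ad] /andP[bc bd] cd _].
move=> /and4P[/and3P[pq pr pt] /andP[qr qt] rt _].
have path_edge x y : x != y -> [set x; y] != [set d; a] ->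
    [set x; y] \in [:: [set a; b]; [set b; c]; [set c; d]; [set d; a]] ->
    [set x; y] \in [:: [set p; q]; [set q; r]; [set r; t]; [set t; p]].
  move=> xy; have [g <-] := K5_edge_of xy.
  rewrite -!mem_cycle_edges4 // => neq_da gC; apply: path_sub.
  by rewrite in_setD1 gC andbT -(inj_eq val_inj) fE.
move: (path_edge a b) (path_edge b c) (path_edge c d) => {path_edge path_sub}.
rewrite !inE eqxx !set2_eqE // 1?eq_sym //.
simpl_distinct => /(_ isT isT isT) + /(_ isT isT isT) + /(_ isT isT isT).
case/or4P=> [/orP[]|/orP[]|/orP[]|/orP[]] /andP[/eqP aE /eqP bE].
all: subst a b; simpl_distinct; rewrite ?orbF ?andbT.
all: move=> /eqP cE; subst c; simpl_distinct; rewrite ?orbF ?andbT.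
all: by move=> /eqP->; simpl_distinct.
Qed.

(** * The minimal tropical basis of R10 *)

Lemma tropical_basis_four_cycles (R : realType) :
  tropical_basis R R10 K5_four_cycles.
Proof.
have four_sub : K5_four_cycles \subset circuits R10 by apply: subsetUl.
split=> //; apply/predeqP => X; split=> [cyc|circ C CF]; last first.
  by apply: circ; apply: (subsetP four_sub).
move=> _ /R10_circuitP[a [b [c [d [Us [->|->]]]]]].
  by apply: cyc; apply/K5_four_cycleP; exists a, b, c, d.
have [e Ue] := fifth_vertex Us.
have [f fE] : exists f : K5_edge, val f = [set a; b].
  by apply: K5_edge_of; move: Us; rewrite /= !inE negb_or; case: eqP.
have [C12 ->] := bowtie_symdiff Ue fE.
move: (Ue); rewrite [uniq _]/= !inE !negb_or.
move=> /and5P[/and4P[ab ac ad ae] /and3P[bc bd be] /andP[cd ce] de _].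
apply: (min_attained_twice_symdiff C12); apply: cyc; apply/K5_four_cycleP.
  by exists a, c, e, b; split; rewrite //= !inE; simpl_distinct.
by exists a, b, d, e; split; rewrite //= !inE; simpl_distinct.
Qed.

Lemma four_cycles_sub_tropical_basis (R : realType) B :
  tropical_basis R R10 B -> K5_four_cycles \subset B.
Proof.
move=> basB; apply/subsetP => C CF.
have [a [b [c [d [Us CE]]]]] := K5_four_cycleP C CF.
have [f fE] : exists f : K5_edge, val f = [set d; a].
  apply: K5_edge_of; move: Us; rewrite /= !inE !negb_or [d == a]eq_sym.
  by case/andP=> /and3P[].
have fC : f \in C by rewrite CE mem_cycle_edges4 // fE !inE eqxx !orbT.
have card_path : #|C :\ f| = 3.
  by have := cardsD1 f C; rewrite fC add1n {1}CE card_cycle_edges4 // => -[<-].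
apply: (tropical_basis_mem (P := C :\ f) basB).
- exact: (subsetP (subsetUl _ _)).
- by rewrite setDDr setDv set0U (setIidPr _) ?cards1 // sub1set.
move=> D DR; rewrite ltnNge; apply: contra => small.
have [p [q [r [t [Ut DE]]]]] := R10_circuitP D DR.
have card_D : #|D| <= #|D :&: (C :\ f)| + 1.
  by rewrite -(cardsID (C :\ f) D) leq_add2l.
have card_meet : #|D :&: (C :\ f)| <= 3.
  by rewrite -card_path subset_leq_card ?subsetIr.
apply/eqP; case: DE => DE; last first.
  (* Here D has six elements, but at most 3 + 1 by the two bounds above. *)
  have := cardsC (cycle_edges [:: p; q; r; t]).
  rewrite -DE card_cycle_edges4 // card_K5_edge => /(@addnI 4 _ 6) card6.
  by rewrite card6 addn1 ltnS in card_D; have := leq_trans card_D card_meet.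
rewrite CE; apply: four_cycle_of_path fE _ _ => //.
  by apply/K5_four_cycleP; exists p, q, r, t.
rewrite -CE; apply/setIidPr/eqP; rewrite eqEcard subsetIr card_path.
by rewrite DE card_cycle_edges4 // addn1 ltnS -DE in card_D.
Qed.

Theorem proposition10 (R : realType) :
  unique (minimal_tropical_basis R R10) K5_four_cycles.
Proof.
apply: unique_minimal_tropical_basis; first exact: tropical_basis_four_cycles.
exact: four_cycles_sub_tropical_basis.
Qed.
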